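(* For every $p\in\mathbb{S}^6$ one has $\Delta(\omega_p)=\{v\in T_p\mathbb{S}^6\mid \iota_v\omega_p\wedge\iota_v\omega_p=0\}=\{0\}$, i.e. $\omega_p$ is of complex type.
   Context: The octonions $\mathbb{O}$ are the real algebra with vector space basis $e_0,e_1,\dots,e_7$, unit $e_0=1$, and products $e_ie_j=-\delta_{ij}+\sum_{k=1}^7\epsilon_{ijk}e_k$ for $i,j\in\{1,\dots,7\}$, where $\epsilon_{ijk}$ is completely antisymmetric, equal to $1$ for $ijk=123,145,167,246,275,374,365$, and $0$ whenever $(i,j,k)$ is not a permutation of one of these triples. The imaginary octonions (span of $e_1,\dots,e_7$) are identified with $\mathbb{R}^7$ with its standard scalar product $\langle\cdot,\cdot\rangle$. The cross product on $\mathbb{R}^7$ is $u\times v:=\frac12(u\cdot v-v\cdot u)$. The constant-coefficient $3$-form $\widetilde\omega$ on $\mathbb{R}^7$ is $\widetilde\omega(u,v,w)=\langle u\times v,w\rangle$. Let $j:\mathbb{S}^6\hookrightarrow\mathbb{R}^7$ be the inclusion of the unit sphere and $\omega:=j^*\widetilde\omega\in\Omega^3(\mathbb{S}^6)$. For a real vector space $V$ of dimension $6$ and $\alpha\in\Lambda^3V^*$, put $\Delta(\alpha):=\{v\in V\mid\iota_v\alpha\wedge\iota_v\alpha=0\}$. A non-degenerate $\alpha$ (i.e. $\iota_v\alpha=0$ implies $v=0$) is, by definition, of complex type if $\Delta(\alpha)=\{0\}$. *)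

(* Defs.v *)
From HB Require Import structures.
From mathcomp Require Import all_boot all_order all_fingroup all_algebra.
From mathcomp Require Import all_classical all_reals all_analysis.
From mathcomp Require Import ring.
Import Order.TTheory GRing.Theory Num.Theory.
Import numFieldNormedType.Exports.

Set Implicit Arguments.
Unset Strict Implicit.
Unset Printing Implicit Defensive.

Local Open Scope classical_set_scope.
Local Open Scope ring_scope.

Section AlternatingForms.
Context (R : realType) (V : lmodType R).

Definition multilinear k (f : ('I_k -> V) -> R^o) : Prop :=
  forall (i : 'I_k) (v : 'I_k -> V) (a : R) (x y : V),
    f (dfwith v i (a *: x + y)) = a *: f (dfwith v i x) + f (dfwith v i y).

Definition alternating k (f : ('I_k -> V) -> R^o) : Prop :=
  forall (v : 'I_k -> V) (i j : 'I_k), i != j -> v i = v j -> f v = 0.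

Definition altforms k : {pred ('I_k -> V) -> R^o} :=
  fun f => `[< multilinear f /\ alternating f >].

Lemma altforms_submod k : submod_closed (@altforms k).
Proof.
split=> [|a f g /asboolP[mf af] /asboolP[mg ag]].
  apply/asboolP; split=> [i v a x y|v i j _ _] //=.
  by rewrite scaler0 addr0.
apply/asboolP; split=> [i v b x y|v i j ij vij].
  rewrite !fctE mf mg !scalerDr !scalerA mulrC -!addrA; congr (_ + _).
  by rewrite addrCA.
by rewrite !fctE (af _ _ _ ij vij) (ag _ _ _ ij vij) scaler0 addr0.
Qed.

HB.instance Definition _ k :=
  GRing.isSubmodClosed.Build R (('I_k -> V) -> R^o) (@altforms k)
    (@altforms_submod k).

Record altform (k : nat) := Altform {
  altfun :> ('I_k -> V) -> R^o;
  altfunP : altfun \in @altforms k }.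

HB.instance Definition _ k := [isSub for @altfun k].
HB.instance Definition _ k := [Choice of altform k by <:].
HB.instance Definition _ k := [SubChoice_isSubLmodule of altform k by <:].

Lemma altformE k (f : altform k) : multilinear f /\ alternating f.
Proof. by have /asboolP := altfunP f. Qed.

Lemma altform_eq0 k (f : altform k) : f = 0 <-> forall v, f v = 0.
Proof.
by split=> [->//|f0]; apply: val_inj; apply/funext => v; exact: f0.
Qed.

Definition vcons k (v : V) (w : 'I_k -> V) : 'I_k.+1 -> V :=
  fun i => if unlift ord0 i is Some j then w j else v.

Lemma iota_subproof k (v : V) (f : altform k.+1) :
  (fun w : 'I_k -> V => f (vcons v w)) \in @altforms k.
Proof.
have [mf af] := altformE f.
have E (w : 'I_k -> V) i x :
    vcons v (dfwith w i x) = dfwith (vcons v w) (lift ord0 i) x.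
  apply/funext => l; rewrite /vcons; case: unliftP => [j ->|->].
    case: (dfwithP w x j) => [|j' ij]; first by rewrite dfwithin.
    have ij' : lift ord0 i != lift ord0 j'.
      by rewrite (inj_eq (@lift_inj _ ord0)).
    by rewrite (dfwithout _ _ ij') /vcons liftK.
  have i0 : lift ord0 i != ord0 by rewrite eq_sym neq_lift.
  by rewrite (dfwithout _ _ i0) /vcons unlift_none.
apply/asboolP; split=> [i w a x y|w i j ij wij].
  by rewrite !E mf.
apply: (af _ (lift ord0 i) (lift ord0 j)).
  by rewrite (inj_eq (@lift_inj _ ord0)).
by rewrite /vcons !liftK.
Qed.

Definition iota_form k (v : V) (f : altform k.+1) : altform k :=
  Altform (iota_subproof v f).

(* The convention is the one for which
   (f /\ g)(v) = 1/(k! l!) sum_s sgn(s) f(v_s1, ..., v_sk) g(v_s(k+1), ...). *)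
Definition wedge_fun k l (f : altform k) (g : altform l) :
    ('I_(k + l) -> V) -> R^o :=
  fun v => (k`!%:R * l`!%:R)^-1 *
    \sum_(s : 'S_(k + l)) (-1) ^+ s *
       (f (fun i => v (s (lshift l i))) * g (fun j => v (s (rshift k j)))).

Lemma wedge_subproof k l (f : altform k) (g : altform l) :
  wedge_fun f g \in @altforms (k + l).
Proof.
have [mf af] := altformE f; have [mg ag] := altformE g.
apply/asboolP; split=> [i v a x y|v i j ij vij]; last first.
  rewrite /wedge_fun; set S := (X in _ * X).
  suff /eqP : S = - S.
    by rewrite -addr_eq0 -mulr2n mulrn_eq0 => /eqP ->; rewrite mulr0.
  rewrite {1}/S (reindex_inj (mulIg (tperm i j))) /= /S -sumrN.
  apply: eq_bigr => s _; rewrite odd_permM odd_tperm ij addbT signrN mulNr.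
  have E (b : 'I_(k + l)) : v ((s * tperm i j)%g b) = v (s b).
    by rewrite permM; case: tpermP => [->|->|].
  by congr (- (_ * (f _ * g _))); apply/funext => b; rewrite E.
rewrite /wedge_fun /GRing.scale /= mulrCA -mulrDr; congr (_ * _).
rewrite mulr_sumr -big_split /=; apply: eq_bigr => s _.
have := permKV s i; case: (split_ordP ((s^-1)%g i)) => b -> <-.
- have Ef z : (fun c => dfwith v (s (lshift l b)) z (s (lshift l c)))
      = dfwith (fun c => v (s (lshift l c))) b z.
    apply/funext => c; case: (eqVneq b c) => [<-|bc].
      by rewrite !dfwithin.
    by rewrite !dfwithout // (inj_eq perm_inj) (inj_eq (@lshift_inj _ _)).
  have Eg z : (fun c => dfwith v (s (lshift l b)) z (s (rshift k c)))
      = fun c => v (s (rshift k c)).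
    by apply/funext => c; rewrite dfwithout // (inj_eq perm_inj) eq_lrshift.
  rewrite (Ef (a *: x + y)) (Ef x) (Ef y) (Eg (a *: x + y)) (Eg x) (Eg y) mf.
  move: (f _) (f _) (g _) (_ ^+ _) => A B C e.
  by rewrite /GRing.scale /= mulrDl mulrDr !mulrA [e * a]mulrC.
- have Eg z : (fun c => dfwith v (s (rshift k b)) z (s (rshift k c)))
      = dfwith (fun c => v (s (rshift k c))) b z.
    apply/funext => c; case: (eqVneq b c) => [<-|bc].
      by rewrite !dfwithin.
    by rewrite !dfwithout // (inj_eq perm_inj) (inj_eq (@rshift_inj _ _)).
  have Ef z : (fun c => dfwith v (s (rshift k b)) z (s (lshift l c)))
      = fun c => v (s (lshift l c)).
    by apply/funext => c; rewrite dfwithout // (inj_eq perm_inj) eq_rlshift.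
  rewrite (Ef (a *: x + y)) (Ef x) (Ef y) (Eg (a *: x + y)) (Eg x) (Eg y) mg.
  move: (g _) (g _) (f _) (_ ^+ _) => A B C e.
  by rewrite /GRing.scale /= !mulrDr !mulrA [e * C * a]mulrC !mulrA.
Qed.

Definition wedge k l (f : altform k) (g : altform l) : altform (k + l) :=
  Altform (wedge_subproof f g).

End AlternatingForms.

Lemma pullback_subproof (R : realType) (U V : lmodType R)
    (h : {linear U -> V}) k (f : altform V k) :
  (fun u : 'I_k -> U => f (fun i => h (u i))) \in @altforms R U k.
Proof.
have [mf af] := altformE f.
have E (u : 'I_k -> U) i x :
    (fun j => h (dfwith u i x j)) = dfwith (fun j => h (u j)) i (h x).
  apply/funext => j; case: (eqVneq i j) => [<-|ij].
    by rewrite !dfwithin.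
  by rewrite !dfwithout.
apply/asboolP; split=> [i u a x y|u i j ij uij].
  by rewrite !E linearP mf.
by apply: (af _ i j ij); rewrite uij.
Qed.

Definition pullback (R : realType) (U V : lmodType R) (h : {linear U -> V}) k
    (f : altform V k) : altform U k :=
  Altform (pullback_subproof h f).

Section ComplexType.
Context (R : realType) (V : vectType R).
Implicit Types alpha : altform V 3.

Definition Delta alpha : set V :=
  [set v | wedge (iota_form v alpha) (iota_form v alpha) = 0].

Definition nondegenerate alpha : Prop :=
  forall v : V, iota_form v alpha = 0 -> v = 0.

Definition complex_type alpha : Prop :=
  [/\ \dim {:V} = 6%N, nondegenerate alpha & Delta alpha = [set 0]].

End ComplexType.

Definition oct_triples : seq (seq nat) :=
  [:: [:: 1; 2; 3]; [:: 1; 4; 5]; [:: 1; 6; 7]; [:: 2; 4; 6];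
      [:: 2; 7; 5]; [:: 3; 7; 4]; [:: 3; 6; 5]]%N.

(* The even (resp. odd) permutations of a triple ijk are the rotations of ijk
   (resp. of jik). *)
Definition is_rot_triple (i j k : nat) : bool :=
  [|| [:: i; j; k] \in oct_triples, [:: j; k; i] \in oct_triples
    | [:: k; i; j] \in oct_triples].

Definition epsilon (i j k : nat) : int :=
  if is_rot_triple i j k then 1 else if is_rot_triple j i k then -1 else 0.

Lemma is_rot_tripleC i j k : is_rot_triple i j k -> ~~ is_rot_triple j i k.
Proof.
rewrite /is_rot_triple /oct_triples !inE !eqseq_cons !andbT.
case: i => [|[|[|[|[|[|[|[|i]]]]]]]] //;
case: j => [|[|[|[|[|[|[|[|j]]]]]]]] //;
by case: k => [|[|[|[|[|[|[|[|k]]]]]]]].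
Qed.

Lemma is_rot_triple_rot i j k : is_rot_triple j k i = is_rot_triple i j k.
Proof.
by rewrite /is_rot_triple orbC [X in X || _]orbC orbC orbCA orbA orbC
           orbA [X in X || _]orbC orbA.
Qed.

Lemma epsilon_rot i j k : epsilon j k i = epsilon i j k.
Proof.
rewrite /epsilon is_rot_triple_rot.
by rewrite (is_rot_triple_rot i k j) (is_rot_triple_rot j i k).
Qed.

Lemma epsilonC i j k : epsilon j i k = - epsilon i j k.
Proof.
rewrite /epsilon; case: (boolP (is_rot_triple i j k)) => [/is_rot_tripleC|_].
  by move/negbTE->.
by case: ifP => _; rewrite ?opprK ?oppr0.
Qed.

Lemma epsilonCr i j k : epsilon i k j = - epsilon i j k.
Proof. by rewrite (epsilon_rot j i k) epsilonC. Qed.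

Lemma epsilon_triples t : t \in oct_triples ->
  epsilon (nth 0%N t 0) (nth 0%N t 1) (nth 0%N t 2) = 1.
Proof.
have /allP h : all (fun t =>
  epsilon (nth 0%N t 0) (nth 0%N t 1) (nth 0%N t 2) == 1) oct_triples by [].
by move=> /h /eqP.
Qed.

Lemma epsilon0 i j k :
  ~~ has (perm_eq [:: i; j; k]) oct_triples -> epsilon i j k = 0.
Proof.
have H a b c : is_rot_triple a b c -> has (perm_eq [:: a; b; c]) oct_triples.
  case/or3P => h; apply/hasP.
  - by exists [:: a; b; c].
  - exists [:: b; c; a] => //; rewrite perm_sym.
    by apply/permPl; exact: (perm_catC [:: b; c] [:: a]).
  - exists [:: c; a; b] => //.
    by apply/permPl; exact: (perm_catC [:: a; b] [:: c]).
rewrite /epsilon => h; case: ifP => [/H hh|_]; first by rewrite hh in h.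
case: ifP => [/H /hasP[t tT pt]|//]; case/hasP: h; exists t => //.
rewrite (perm_trans _ pt) //.
by apply/permPl; exact: (perm_catCA [:: i] [:: j] [:: k]).
Qed.

Section Octonions.
Context (R : realType).

(* Octonions are represented by their coordinates in the basis e_0, ..., e_7. *)
Definition oct_e (i : 'I_8) : 'rV[R]_8 := delta_mx 0 i.

Definition oct_basis_mul (i j : 'I_8) : 'rV[R]_8 :=
  if i == 0 then oct_e j
  else if j == 0 then oct_e i
  else - (i == j)%:R *: oct_e 0
       + \sum_(k < 8 | k != 0) (epsilon i j k)%:~R *: oct_e k.

Definition oct_mul (x y : 'rV[R]_8) : 'rV[R]_8 :=
  \sum_(i < 8) \sum_(j < 8) (x 0 i * y 0 j) *: oct_basis_mul i j.

(* The coordinate of index i : 'I_7 of a vector of R^7 is the coefficient of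
   e_(i+1). *)
Definition oct_im (u : 'rV[R]_7) : 'rV[R]_8 := row_mx (0 : 'rV[R]_1) u.

Definition im_part (x : 'rV[R]_8) : 'rV[R]_7 := rsubmx (x : 'rV[R]_(1 + 7)).

Definition cross (u v : 'rV[R]_7) : 'rV[R]_7 :=
  im_part (2^-1 *:
    (oct_mul (oct_im u) (oct_im v) - oct_mul (oct_im v) (oct_im u))).

Definition dot n (u v : 'rV[R]_n) : R^o := \sum_i u 0 i * v 0 i.

Lemma dot_linear n (u : 'rV[R]_n) : linear (dot u).
Proof.
move=> a v w; rewrite /dot scaler_sumr -big_split /=; apply: eq_bigr => i _.
by rewrite !mxE /GRing.scale /=; ring.
Qed.

HB.instance Definition _ n (u : 'rV[R]_n) :=
  GRing.isLinear.Build R 'rV[R]_n R^o *:%R (dot u) (dot_linear u).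

Lemma dotC n (u v : 'rV[R]_n) : dot u v = dot v u.
Proof. by apply: eq_bigr => i _; rewrite mulrC. Qed.

Lemma oct_im0 u : oct_im u 0 0 = 0.
Proof.
have -> : (0 : 'I_8) = lshift 7 (0 : 'I_1) by apply: val_inj.
by rewrite /oct_im (row_mxEl (0 : 'rV_1) u) mxE.
Qed.

Lemma oct_imS u (i : 'I_7) : oct_im u 0 (lift 0 i) = u 0 i.
Proof.
have -> : (lift 0 i : 'I_8) = rshift 1 i by apply: val_inj.
by rewrite /oct_im (row_mxEr (0 : 'rV_1) u).
Qed.

Lemma oct_mul_im u v : oct_mul (oct_im u) (oct_im v) =
  \sum_(i < 7) \sum_(j < 7)
    (u 0 i * v 0 j) *: oct_basis_mul (lift 0 i) (lift 0 j).
Proof.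
rewrite /oct_mul big_ord_recl big1 ?add0r; last first.
  by move=> j _; rewrite oct_im0 mul0r scale0r.
apply: eq_bigr => i _; rewrite big_ord_recl oct_im0 mulr0 scale0r add0r.
by apply: eq_bigr => j _; rewrite !oct_imS.
Qed.

Lemma oct_eE (i k : 'I_8) : oct_e i 0 k = (k == i)%:R.
Proof. by rewrite mxE. Qed.

Lemma oct_basis_mulE (i j : 'I_7) (k : 'I_8) :
  oct_basis_mul (lift 0 i) (lift 0 j) 0 k =
  - (i == j)%:R * (k == 0)%:R + (k != 0)%:R * (epsilon i.+1 j.+1 k)%:~R.
Proof.
have l0 (l : 'I_7) : (lift 0 l == 0 :> 'I_8) = false by [].
rewrite /oct_basis_mul !l0 (inj_eq (@lift_inj _ _)) mxE.
rewrite [X in X + _]mxE oct_eE summxE; congr (_ + _).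
have [->|k0] := eqVneq k 0.
  rewrite mul0r big1 // => l l0'.
  by rewrite mxE oct_eE eq_sym (negbTE l0') mulr0.
rewrite (bigD1 k) //= big1 ?addr0 => [|l /andP[_ lk]].
  by rewrite mxE oct_eE eqxx mulr1 mul1r.
by rewrite mxE oct_eE eq_sym (negbTE lk) mulr0.
Qed.

Lemma oct_basis_mul0 (i j : 'I_7) :
  oct_basis_mul (lift 0 i) (lift 0 j) 0 0 = - (i == j)%:R.
Proof. by rewrite oct_basis_mulE eqxx mulr1 mul0r addr0. Qed.

Lemma oct_basis_mulS (i j k : 'I_7) :
  oct_basis_mul (lift 0 i) (lift 0 j) 0 (lift 0 k) =
  (epsilon i.+1 j.+1 k.+1)%:~R.
Proof. by rewrite oct_basis_mulE mulr0 add0r mul1r. Qed.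

Lemma im_partE x (k : 'I_7) : im_part x 0 k = x 0 (lift 0 k).
Proof. by rewrite mxE; congr (x _ _); apply: val_inj. Qed.

Lemma crossE u v (k : 'I_7) : cross u v 0 k =
  \sum_(i < 7) \sum_(j < 7) (epsilon i.+1 j.+1 k.+1)%:~R * (u 0 i * v 0 j).
Proof.
have E x y : oct_mul (oct_im x) (oct_im y) 0 (lift 0 k) =
    \sum_(i < 7) \sum_(j < 7) (epsilon i.+1 j.+1 k.+1)%:~R * (x 0 i * y 0 j).
  rewrite oct_mul_im summxE; apply: eq_bigr => i _.
  rewrite summxE; apply: eq_bigr => j _.
  by rewrite mxE oct_basis_mulS mulrC.
rewrite /cross im_partE mxE [X in _ * X]mxE [X in _ + X]mxE !E.
rewrite [X in _ - X]exchange_big /=.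
set S := (X in _ = X); rewrite -[X in _ * (_ - X)]opprK -sumrN.
have -> : \sum_(i < 7) - (\sum_(j < 7) (epsilon j.+1 i.+1 k.+1)%:~R *
    (v 0 j * u 0 i)) = S.
  apply: eq_bigr => i _; rewrite -sumrN; apply: eq_bigr => j _.
  by rewrite epsilonC rmorphN /= mulNr opprK [v 0 j * _]mulrC.
by rewrite opprK -/S -mulr2n -[S *+ 2]mulr_natl mulKf // pnatr_eq0.
Qed.

(* The commutator of two imaginary octonions is imaginary, so that cross u v
   is indeed half of it. *)
Lemma oct_im_cross u v : oct_im (cross u v) =
  2^-1 *: (oct_mul (oct_im u) (oct_im v) - oct_mul (oct_im v) (oct_im u)).
Proof.
apply/rowP => k; case: (unliftP 0 k) => [l ->|->].
  by rewrite oct_imS im_partE.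
have E x y : oct_mul (oct_im x) (oct_im y) 0 0 = - dot x y.
  rewrite oct_mul_im summxE -sumrN; apply: eq_bigr => i _.
  rewrite summxE (bigD1 i) //= big1 ?addr0 => [|j ji]; last first.
    by rewrite mxE oct_basis_mul0 eq_sym (negbTE ji) oppr0 mulr0.
  by rewrite mxE oct_basis_mul0 eqxx mulrN1.
rewrite oct_im0 mxE [X in _ * X]mxE [X in _ + X]mxE !E dotC subrr.
by rewrite mulr0.
Qed.

Definition omega_tilde_fun (w : 'I_3 -> 'rV[R]_7) : R^o :=
  dot (cross (w 0) (w 1)) (w 2).

Lemma omega_tilde_funE w : omega_tilde_fun w =
  \sum_(i < 7) \sum_(j < 7) \sum_(k < 7)
    (epsilon i.+1 j.+1 k.+1)%:~R * (w 0 0 i * w 1 0 j * w 2 0 k).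
Proof.
rewrite /omega_tilde_fun /dot.
under eq_bigr => k _ do rewrite crossE mulr_suml.
rewrite exchange_big; apply: eq_bigr => i _ /=.
under eq_bigr => k _ do rewrite mulr_suml.
rewrite exchange_big; apply: eq_bigr => j _ /=.
by apply: eq_bigr => k _; rewrite -!mulrA.
Qed.

Lemma omega_tilde_subproof : omega_tilde_fun \in @altforms R 'rV[R]_7 3.
Proof.
have ord3 (i : 'I_3) : [\/ i = 0, i = 1 | i = 2].
  case: i => -[|[|[|//]]] h.
  - by constructor 1; apply: val_inj.
  - by constructor 2; apply: val_inj.
  - by constructor 3; apply: val_inj.
have neg0 (x : R) : x = - x -> x = 0.
  by move/eqP; rewrite -addr_eq0 -mulr2n mulrn_eq0 => /eqP.
apply/asboolP; split=> [i w a x y|w i j ij wij].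
  rewrite !omega_tilde_funE scaler_sumr -big_split; apply: eq_bigr => b _ /=.
  rewrite scaler_sumr -big_split; apply: eq_bigr => c _ /=.
  rewrite scaler_sumr -big_split; apply: eq_bigr => d _ /=.
  rewrite /GRing.scale /=; move: (_%:~R) => e.
  have [->|->|->] := ord3 i; rewrite !dfwithin !dfwithout // !mxE; ring.
have E01 (v : 'I_3 -> 'rV[R]_7) : v 0 = v 1 -> omega_tilde_fun v = 0.
  move=> v01; rewrite /omega_tilde_fun /cross v01 subrr scaler0.
  have -> : im_part 0 = 0 by apply/rowP => l; rewrite im_partE !mxE.
  by rewrite dotC raddf0.
have E12 (v : 'I_3 -> 'rV[R]_7) : v 1 = v 2 -> omega_tilde_fun v = 0.
  move=> v12; apply: neg0; rewrite omega_tilde_funE v12 -sumrN.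
  apply: eq_bigr => b _; rewrite [LHS]exchange_big -sumrN; apply: eq_bigr => c _.
  rewrite -sumrN; apply: eq_bigr => d _.
  by rewrite epsilonCr rmorphN mulNr; congr (- (_ * _)); rewrite mulrAC.
have E02 (v : 'I_3 -> 'rV[R]_7) : v 0 = v 2 -> omega_tilde_fun v = 0.
  move=> v02; apply: neg0; rewrite omega_tilde_funE v02.
  rewrite [LHS]exchange_big [X in - X]exchange_big -sumrN.
  apply: eq_bigr => c _; rewrite [LHS]exchange_big -sumrN.
  apply: eq_bigr => b _; rewrite -sumrN; apply: eq_bigr => d _.
  rewrite (epsilonC c.+1 d.+1 b.+1) (epsilon_rot b.+1 c.+1 d.+1) rmorphN mulNr.
  congr (- (_ * _)).
  by rewrite mulrAC [RHS]mulrAC; congr (_ * _); rewrite mulrC.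
move: ij wij; have [->|->|->] := ord3 i; have [->|->|->] := ord3 j => // _.
- exact: E01.
- exact: E02.
- by move/esym; exact: E01.
- exact: E12.
- by move/esym; exact: E02.
- by move/esym; exact: E12.
Qed.

Definition omega_tilde : altform 'rV[R]_7 3 := Altform omega_tilde_subproof.

(* The norm of the library on 'rV[R]_7 is the sup norm, so the Euclidean
   sphere is given through the scalar product. *)
Definition S6 := {p : 'rV[R]_7 | dot p p == 1}.

(* The embedded tangent space: it is identified by the differential of the
   inclusion S^6 -> R^7 with the kernel at p of the differential of
   x |-> <x, x>, which is 2 <p, .>. *)
Definition tangent (p : S6) : {vspace 'rV[R]_7} := lker (linfun (dot (val p))).

Lemma mem_tangent p v : (v \in tangent p) = (dot (val p) v == 0).
Proof. by rewrite memv_ker lfunE. Qed.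

Lemma dim_tangent p : \dim (tangent p) = 6%N.
Proof.
set f := linfun (dot (val p)).
have dR : \dim (limg f) = 1%N.
  have fp : f (val p) = 1 by rewrite lfunE; apply/eqP; exact: valP p.
  apply/eqP; rewrite eqn_leq (leq_trans (dimvS (subvf _))) ?dimvf //=.
  rewrite lt0n dimv_eq0; apply/eqP => f0.
  have : f (val p) \in 0%VS by rewrite -f0 memv_img ?memvf.
  by rewrite fp memv0 oner_eq0.
have := limg_ker_dim f fullv.
by rewrite capfv dimvf dR addn1 => -[].
Qed.

Lemma is_derive_rVP n (c : R -> 'rV[R]_n.+1) (t : R) (v : 'rV[R]_n.+1) :
  is_derive t 1 c v <-> forall i, is_derive t 1 (fun x => c x 0 i) (v 0 i).
Proof.
split=> [[dc <-] i|dc].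
  split; first by move/derivable_mxP : dc; exact.
  by rewrite derive_mx // mxE.
have dc' : derivable c t 1.
  by apply/derivable_mxP => a i; rewrite (ord1 a); case: (dc i).
split=> //; apply/rowP => i; rewrite derive_mx // mxE.
by case: (dc i).
Qed.

Lemma tangentP (p : S6) (v : 'rV[R]_7) : v \in tangent p <->
  exists c : R -> 'rV[R]_7,
    [/\ forall t, dot (c t) (c t) = 1, c 0 = val p & is_derive (0 : R) 1 c v].
Proof.
have pp : dot (val p) (val p) = 1 by apply/eqP; exact: valP p.
move: (val p) pp (mem_tangent p v) => q qq ->.
split=> [/eqP qv|[c [c1 c0 cv]]].
  pose k : R := dot v v / 4.
  have k0 : 0 <= k.
    by rewrite divr_ge0 // sumr_ge0 // => i _; rewrite -expr2 sqr_ge0.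
  have den0 t : 1 + k * t ^+ 2 != 0.
    by rewrite gt_eqF // ltr_wpDr // mulr_ge0 ?sqr_ge0.
  pose c t := (1 + k * t ^+ 2)^-1 *: ((1 - k * t ^+ 2) *: q + t *: v).
  have dotDD (x y : R) : dot (x *: q + y *: v) (x *: q + y *: v) =
      x ^+ 2 * dot q q + 2 * x * y * dot q v + y ^+ 2 * dot v v.
    rewrite /dot !mulr_sumr -!big_split /=; apply: eq_bigr => i _.
    by rewrite !mxE; ring.
  exists c; split.
  - move=> t; rewrite /c linearZ /= dotC linearZ /= dotDD qq qv /GRing.scale /=.
    have -> : dot v v = 4 * k by rewrite /k; field.
    by field; exact: den0.
  - by rewrite /c expr0n mulr0 addr0 subr0 invr1 !scale1r scale0r addr0.
  - apply/is_derive_rVP => i.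
    pose d : {poly R} := 1%:P + k *: 'X^2.
    pose h : {poly R} := (q 0 i)%:P + v 0 i *: 'X - (k * q 0 i) *: 'X^2.
    have dE t : d.[t] = 1 + k * t ^+ 2.
      by rewrite hornerD hornerC hornerZ hornerXn.
    have hE t : h.[t] = q 0 i + v 0 i * t - k * q 0 i * t ^+ 2.
      by rewrite hornerD hornerN hornerD hornerC !hornerZ hornerX hornerXn.
    have d'0 : d^`().[0] = 0.
      by rewrite derivD derivC add0r derivZ derivXn hornerZ hornerMn hornerX
        mul0rn mulr0.
    have h'0 : h^`().[0] = v 0 i.
      rewrite derivB derivD derivC add0r !derivZ derivX derivXn hornerD hornerN.
      by rewrite !hornerZ hornerMn hornerX mul0rn hornerC mulr0 subr0 mulr1.
    have -> : (fun t => c t 0 i) = (fun t => (d.[t])^-1) * horner h.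
      apply/funext => t; rewrite /c !mxE /= -[RHS]/((d.[t])^-1 * h.[t]).
      by rewrite dE hE; congr (_ * _); ring.
    have dd : is_derive (0 : R) 1 (fun t => (d.[t])^-1) 0.
      have d0 : d.[0] != 0 by rewrite dE den0.
      apply: (is_derive_eq (is_deriveV d0 (is_derive_poly d 0))).
      by rewrite d'0 scaler0.
    apply: (is_derive_eq (is_deriveM dd (is_derive_poly h 0))).
    by rewrite h'0 scaler0 addr0 dE expr0n mulr0 addr0 invr1 scale1r.
have dc := (is_derive_rVP _ _ _).1 cv.
have : is_derive (0 : R) 1 (\sum_(i < 7) (fun t => c t 0 i) * (fun t => c t 0 i))
    (\sum_(i < 7) (q 0 i * v 0 i + q 0 i * v 0 i)).
  apply: is_derive_sum => i.
  by apply: (is_derive_eq (is_deriveM (dc i) (dc i))); rewrite c0.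
have -> : \sum_(i < 7) (fun t => c t 0 i) * (fun t => c t 0 i) = cst 1.
  by apply/funext => t; rewrite fct_sumE -(c1 t).
rewrite big_split /= -/(dot q v) => -[_]; rewrite derive_cst => /esym/eqP.
by rewrite -mulr2n mulrn_eq0.
Qed.

Definition omega (p : S6) : altform (subvs_of (tangent p)) 3 :=
  pullback (@vsval R 'rV[R]_7 (tangent p)) omega_tilde.

End Octonions.

(* Main.v *)
Require Import Defs.
From mathcomp Require Import all_boot all_order all_fingroup all_algebra.
From mathcomp Require Import all_classical all_reals all_analysis.
From mathcomp Require Import ring.
Import Order.TTheory GRing.Theory Num.Theory.

Local Open Scope classical_set_scope.
Local Open Scope ring_scope.

(** Put [beta] for the 2-form [iota_v omega_p] on [T_p S^6], so that
    [beta(a, b) = <v x a, b>].  For [v] orthogonal to [p] and nonzero, the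
    octonions generated by [v] and [p] form a quaternion subalgebra with
    imaginary part spanned by [v], [p] and [v x p]; its orthogonal complement
    is a 4-dimensional subspace of [T_p S^6], stable under [v x -] and
    [p x -], on which [v x -] is [|v|] times a complex structure.  Hence
    [beta] is symplectic there, and its square does not vanish.

    Concretely, pick [c != 0] orthogonal to [p], [v] and [v x p]
    ([exists_orthogonal]), and evaluate [beta /\ beta] on
      [c, v x c, p x c, v x (p x c)].
    The identity [<u x a, u x b> = |u|^2 <a, b> - <u, a> <u, b>]
    ([cross_cross_dot]) and the total antisymmetry of [<u x a, b>] give
    [beta_02 = beta_03 = 0] and [beta_01 = beta_23 = |v|^2 |c|^2], so that
    [2 (beta_01 beta_23 - beta_02 beta_13 + beta_03 beta_12)], which is the
    value of the square by [wedge22E], equals [2 |v|^4 |c|^4 > 0].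

    Nondegeneracy follows, as [iota_v omega_p = 0] forces
    [iota_v omega_p /\ iota_v omega_p = 0]. *)

(** * The wedge product of two 2-forms *)

(** The bijection behind the Laplace expansion: a permutation is the image [i]
    of [0] together with a permutation of what remains.  Iterating it turns a
    sum over ['S_n], for a numeral [n], into an explicit one. *)
Lemma sum_perm_lift {R : nmodType} {n} (F : 'S_n.+1 -> R) :
  \sum_s F s = \sum_(i < n.+1) \sum_(t : 'S_n) F (lift_perm ord0 i t).
Proof.
rewrite pair_big; apply: (reindex (fun u => lift_perm ord0 u.1 u.2)).
apply: onW_bij; apply: inj_card_bij => [[i s] [j t] /= e|].
  have ij : i = j by rewrite -(lift_perm_id ord0 i s) e lift_perm_id.
  rewrite -ij in e *; congr (_, _); apply/permP => k.
  by apply: (@lift_inj _ i); rewrite -!(lift_perm_lift ord0 i) e.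
by rewrite card_prod !card_Sn card_ord factS.
Qed.

(** The functions take natural numbers, and not elements of ['I_4], so that
    the values of the explicit permutations are found by computation. *)
Lemma sum_S4 {R : comNzRingType} {F G : nat -> nat -> R} :
  (forall i j, F j i = - F i j) -> (forall i j, G j i = - G i j) ->
  \sum_(s : 'S_4) (-1) ^+ s * (F (s 0) (s 1) * G (s 2) (s 3)) =
  4 * (F 0%N 1%N * G 2%N 3%N - F 0%N 2%N * G 1%N 3%N + F 0%N 3%N * G 1%N 2%N
     + F 1%N 2%N * G 0%N 3%N - F 1%N 3%N * G 0%N 2%N + F 2%N 3%N * G 0%N 1%N).
Proof.
move=> FN GN.
have e0 : (0 : 'I_4) = ord0 by [].
have e1 : (1 : 'I_4) = lift ord0 ord0 by apply: val_inj.
have e2 : (2 : 'I_4) = lift ord0 (lift ord0 ord0) by apply: val_inj.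
have e3 : (3 : 'I_4) = lift ord0 (lift ord0 (lift ord0 ord0)) by apply: val_inj.
have S0 (H : 'S_0 -> R) : \sum_s H s = H 1%g.
  rewrite (bigD1 1%g) //= big1 ?addr0 // => s /negP[]; apply/eqP/permP.
  by case.
rewrite sum_perm_lift; under eq_bigr do rewrite sum_perm_lift.
under eq_bigr do under eq_bigr do rewrite sum_perm_lift.
under eq_bigr do under eq_bigr do under eq_bigr do rewrite sum_perm_lift.
under eq_bigr do under eq_bigr do under eq_bigr do under eq_bigr do rewrite S0.
rewrite e3 e2 e1 e0.
under eq_bigr do under eq_bigr do under eq_bigr do under eq_bigr do
  rewrite !odd_lift_perm !(lift_perm_lift, lift_perm_id) odd_perm1.
rewrite !big_ord_recl !big_ord0 /= /bump /=.
(* Orient every pair of indices increasingly. *)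
rewrite !(FN 0 1)%N !(FN 0 2)%N !(FN 0 3)%N !(FN 1 2)%N !(FN 1 3)%N !(FN 2 3)%N.
rewrite !(GN 0 1)%N !(GN 0 2)%N !(GN 0 3)%N !(GN 1 2)%N !(GN 1 3)%N !(GN 2 3)%N.
ring.
Qed.

Section ZeroForms.
Context {R : realType} {V : lmodType R}.

Lemma iota_form0 {k} (f : altform V k.+1) : iota_form 0 f = 0.
Proof.
apply/altform_eq0 => w; have [mf _] := altformE f.
have w0 : dfwith (vcons 0 w) ord0 0 = vcons 0 w.
  apply/funext => i; case: dfwithP => //.
  by rewrite /vcons unlift_none.
have := mf ord0 (vcons 0 w) 1 0 0.
rewrite !scale1r addr0 w0 => /eqP.
by rewrite -subr_eq subrr eq_sym => /eqP.
Qed.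

Lemma wedge0f {k l} (g : altform V l) : wedge (0 : altform V k) g = 0.
Proof.
apply/altform_eq0 => w; rewrite /= /wedge_fun big1 ?mulr0 // => s _.
by rewrite mul0r mulr0.
Qed.

End ZeroForms.

Section TwoForms.
Context {R : realType} {V : lmodType R}.
Implicit Types (a b v : V) (f g : altform V 2).

Definition pair2 a b : 'I_2 -> V := fun i => if i == 0 then a else b.

Lemma ord2E (i : 'I_2) : i = 0 \/ i = 1.
Proof. by case: i => -[|[|//]] h; [left|right]; apply: val_inj. Qed.

Lemma dfwith_pair20 a b x : dfwith (pair2 a b) 0 x = pair2 x b.
Proof.
apply/funext => i; rewrite /pair2.
by case: (ord2E i) => ->; rewrite ?dfwithin ?dfwithout.
Qed.

Lemma dfwith_pair21 a b x : dfwith (pair2 a b) 1 x = pair2 a x.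
Proof.
apply/funext => i; rewrite /pair2.
by case: (ord2E i) => ->; rewrite ?dfwithin ?dfwithout.
Qed.

Lemma vcons_pair2 v a b :
  (vcons v (pair2 a b) 0 = v) * (vcons v (pair2 a b) 1 = a) *
  (vcons v (pair2 a b) 2 = b).
Proof.
have e1 : (1 : 'I_3) = lift ord0 0 by apply: val_inj.
have e2 : (2 : 'I_3) = lift ord0 1 by apply: val_inj.
by rewrite /vcons e2 e1 unlift_none !liftK /pair2.
Qed.

Lemma altform2C f a b : f (pair2 b a) = - f (pair2 a b).
Proof.
have [mf af] := altformE f.
have f0 x : f (pair2 x x) = 0 by apply: (af _ 0 1).
have fDl x y z : f (pair2 (x + y) z) = f (pair2 x z) + f (pair2 y z).
  by have := mf 0 (pair2 0 z) 1 x y; rewrite !dfwith_pair20 !scale1r.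
have fDr x y z : f (pair2 z (x + y)) = f (pair2 z x) + f (pair2 z y).
  by have := mf 1 (pair2 z 0) 1 x y; rewrite !dfwith_pair21 !scale1r.
have := f0 (a + b); rewrite fDl !fDr !f0 add0r addr0 addrC.
by move/eqP; rewrite addr_eq0 => /eqP.
Qed.

Lemma wedge22E f g (xs : seq V) :
  let F i j : R := f (pair2 xs`_i xs`_j) in
  let G i j : R := g (pair2 xs`_i xs`_j) in
  wedge f g (fun i : 'I_4 => xs`_i) =
    F 0%N 1%N * G 2%N 3%N - F 0%N 2%N * G 1%N 3%N + F 0%N 3%N * G 1%N 2%N
  + F 1%N 2%N * G 0%N 3%N - F 1%N 3%N * G 0%N 2%N + F 2%N 3%N * G 0%N 1%N.
Proof.
move=> F G.
have FN i j : F j i = - F i j by exact: altform2C.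
have GN i j : G j i = - G i j by exact: altform2C.
rewrite -[RHS](mulKf (_ : 4 != 0 :> R)) ?pnatr_eq0 // -(sum_S4 FN GN).
rewrite /= /wedge_fun !factS fact0 -natrM; congr (_ * _).
apply: eq_bigr => s _; rewrite /F /G /=; congr (_ * (f _ * g _));
  apply/funext => i; rewrite /pair2.
- by case: (ord2E i) => -> /=; congr (xs`_(s _)); apply: val_inj.
- by case: (ord2E i) => -> /=; congr (xs`_(s _)); apply: val_inj.
Qed.

End TwoForms.

(** * The cross product of imaginary octonions *)

Ltac compute_epsilon :=
  repeat match goal with |- context [epsilon ?i ?j ?k] =>
    let e := eval vm_compute in (epsilon i j k) in
    change (epsilon i j k) with e
  end.

Lemma sum_I7 (V : nmodType) (F : 'I_7 -> V) :
  \sum_i F i = F 0 + F 1 + F 2 + F 3 + F 4 + F 5 + F 6.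
Proof.
rewrite !big_ord_recr big_ord0 /= add0r.
by do ![congr (_ + _)]; congr (F _); apply: val_inj.
Qed.

Section CrossProduct.
Context {R : realType}.
Implicit Types u v w x y : 'rV[R]_7.

Lemma cross_coordE u v :
  (cross u v 0 0 = u 0 1 * v 0 2 - u 0 2 * v 0 1 + u 0 3 * v 0 4
                   - u 0 4 * v 0 3 + u 0 5 * v 0 6 - u 0 6 * v 0 5) *
  (cross u v 0 1 = u 0 2 * v 0 0 - u 0 0 * v 0 2 + u 0 3 * v 0 5
                   - u 0 5 * v 0 3 + u 0 6 * v 0 4 - u 0 4 * v 0 6) *
  (cross u v 0 2 = u 0 0 * v 0 1 - u 0 1 * v 0 0 + u 0 6 * v 0 3
                   - u 0 3 * v 0 6 + u 0 5 * v 0 4 - u 0 4 * v 0 5) *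
  (cross u v 0 3 = u 0 4 * v 0 0 - u 0 0 * v 0 4 + u 0 5 * v 0 1
                   - u 0 1 * v 0 5 + u 0 2 * v 0 6 - u 0 6 * v 0 2) *
  (cross u v 0 4 = u 0 0 * v 0 3 - u 0 3 * v 0 0 + u 0 1 * v 0 6
                   - u 0 6 * v 0 1 + u 0 2 * v 0 5 - u 0 5 * v 0 2) *
  (cross u v 0 5 = u 0 6 * v 0 0 - u 0 0 * v 0 6 + u 0 1 * v 0 3
                   - u 0 3 * v 0 1 + u 0 4 * v 0 2 - u 0 2 * v 0 4) *
  (cross u v 0 6 = u 0 0 * v 0 5 - u 0 5 * v 0 0 + u 0 4 * v 0 1
                   - u 0 1 * v 0 4 + u 0 3 * v 0 2 - u 0 2 * v 0 3).
Proof.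
do !split; rewrite crossE !sum_I7; compute_epsilon;
  rewrite !(mulr0z, mulr1z, NegzE, mulrN1z);
  move: (u 0 0) (u 0 1) (u 0 2) (u 0 3) (u 0 4) (u 0 5) (u 0 6)
        (v 0 0) (v 0 1) (v 0 2) (v 0 3) (v 0 4) (v 0 5) (v 0 6) => *; ring.
Qed.

Lemma crossC u v : cross v u = - cross u v.
Proof.
by rewrite /cross -opprB scalerN; apply/rowP => k; rewrite !(im_partE, mxE).
Qed.

Lemma dotNl u v : dot (- u) v = - dot u v.
Proof. by rewrite dotC raddfN /= dotC. Qed.

Lemma dot_cross u v w : dot (cross u v) w = dot u (cross v w).
Proof.
rewrite /dot !sum_I7 !cross_coordE.
move: (u 0 0) (u 0 1) (u 0 2) (u 0 3) (u 0 4) (u 0 5) (u 0 6)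
      (v 0 0) (v 0 1) (v 0 2) (v 0 3) (v 0 4) (v 0 5) (v 0 6)
      (w 0 0) (w 0 1) (w 0 2) (w 0 3) (w 0 4) (w 0 5) (w 0 6) => *; ring.
Qed.

Lemma dot_crossl u v : dot u (cross u v) = 0.
Proof.
rewrite -dot_cross /cross subrr scaler0 dotC.
have -> : im_part 0 = 0 :> 'rV[R]_7 by apply/rowP => k; rewrite im_partE !mxE.
exact: raddf0.
Qed.

Lemma dot_crossr u v : dot v (cross u v) = 0.
Proof. by rewrite crossC raddfN /= dot_crossl oppr0. Qed.

(** The polarization of [|u x x|^2 = |u|^2 |x|^2 - <u, x>^2], which expresses
    that the norm of the octonions is multiplicative. *)
Lemma cross_cross_dot u x y :
  dot (cross u x) (cross u y) = dot u u * dot x y - dot u x * dot u y.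
Proof.
rewrite /dot !sum_I7 !cross_coordE.
move: (u 0 0) (u 0 1) (u 0 2) (u 0 3) (u 0 4) (u 0 5) (u 0 6)
      (x 0 0) (x 0 1) (x 0 2) (x 0 3) (x 0 4) (x 0 5) (x 0 6)
      (y 0 0) (y 0 1) (y 0 2) (y 0 3) (y 0 4) (y 0 5) (y 0 6) => *; ring.
Qed.

End CrossProduct.

Lemma dot_eq0 (R : realType) n (u : 'rV[R]_n) : (dot u u == 0) = (u == 0).
Proof.
apply/eqP/eqP => [u0|->]; last exact: raddf0.
apply/rowP => i; rewrite mxE; apply/eqP.
rewrite -sqrf_eq0 expr2; apply/eqP.
by apply: (psumr_eq0P _ u0) => // j _; rewrite -expr2 sqr_ge0.
Qed.

Lemma exists_orthogonal (R : realType) m n (w : 'I_m -> 'rV[R]_n) :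
  (m < n)%N -> exists2 c, c != 0 & forall i, dot (w i) c = 0.
Proof.
move=> mn; pose A := \matrix_(i < n, j < m) w j 0 i.
have /rowV0Pn[c cA c0] : kermx A != 0.
  rewrite kermx_eq0 /row_free; apply/eqP => rA.
  by have := rank_leq_col A; rewrite rA leqNgt mn.
exists c => // j; move: cA => /sub_kermxP/rowP/(_ j).
rewrite !mxE => <-; rewrite dotC; apply: eq_bigr => i _.
by rewrite mxE.
Qed.

(** * The form on the sphere *)

Section Sphere.
Context {R : realType} (p : S6 R).
Implicit Types v a b : subvs_of (tangent p).

Lemma iota_omegaE v a b :
  iota_form v (omega p) (pair2 a b) = dot (cross (vsval v) (vsval a)) (vsval b).
Proof. by rewrite /= /omega_tilde_fun !vcons_pair2. Qed.

(** The witnesses span the orthogonal complement of [p], [v] and [v x p], a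
    4-dimensional symplectic subspace for [iota_v omega_p]. *)
Lemma wedge_iota_omega_neq0 v : v != 0 ->
  wedge (iota_form v (omega p)) (iota_form v (omega p)) <> 0.
Proof.
move=> v0; set q := val p; set u := vsval v.
have qu : dot q u = 0 by apply/eqP; rewrite -mem_tangent subvsP.
have uu : dot u u != 0 by rewrite dot_eq0.
have qq : dot q q = 1 by apply/eqP/(valP p).
have [c c0 wc] := @exists_orthogonal R 3 7
  (fun i => [:: q; u; cross u q]`_i) isT.
have cc : dot c c != 0 by rewrite dot_eq0.
have qc : dot q c = 0 := wc 0.
have uc : dot u c = 0 := wc 1.
have uqc : dot (cross u q) c = 0 := wc 2.
have quc : dot (cross q u) c = 0 by rewrite crossC dotNl uqc oppr0.
have tc : c \in tangent p by rewrite mem_tangent qc.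
have tuc : cross u c \in tangent p by rewrite mem_tangent -dot_cross quc.
have tqc : cross q c \in tangent p by rewrite mem_tangent dot_crossl.
have tuqc : cross u (cross q c) \in tangent p.
  by rewrite mem_tangent -dot_cross cross_cross_dot uc qc !mulr0 subrr.
pose xs := [:: Subvs tc; Subvs tuc; Subvs tqc; Subvs tuqc].
move/altform_eq0/(_ (fun i : 'I_4 => xs`_i))/eqP; apply/negP.
(* On these vectors the form pairs the first with the second, and the third
   with the fourth; both values are [N]. *)
pose N : R := dot u u * dot c c.
have pf (F01 F23 F02 F13 F03 F12 : R) :
    F01 = N -> F23 = N -> F02 = 0 -> F03 = 0 ->
    F01 * F23 - F02 * F13 + F03 * F12 + F12 * F03 - F13 * F02 + F23 * F01
    = N ^+ 2 *+ 2.
  by move=> -> -> -> ->; ring.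
rewrite wedge22E !iota_omegaE /= -/u pf; first last.
- by rewrite cross_cross_dot dot_crossr uc mulr0 mul0r subrr.
- rewrite !(crossC c) dotNl raddfN /= cross_cross_dot (dotC c u) uc.
  by rewrite (dotC u) qu mulr0 mul0r subrr !oppr0.
- by rewrite !cross_cross_dot -(dot_cross u) uqc qq qc !mul0r !subr0 mul1r.
- by rewrite cross_cross_dot uc mul0r subr0.
by rewrite mulrn_eq0 /= sqrf_eq0 mulf_neq0.
Qed.

Lemma Delta_omega : Delta (omega p) = [set 0].
Proof.
apply/seteqP; split=> v /=.
  by move=> vD; apply/eqP/contraT => /wedge_iota_omega_neq0.
by move=> ->; rewrite /Delta /= iota_form0 wedge0f.
Qed.

End Sphere.

Theorem lemma2p12 (R : realType) (p : S6 R) :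
  [/\ Delta (omega p) =
        [set v : subvs_of (tangent p) |
           wedge (iota_form v (omega p)) (iota_form v (omega p)) = 0],
      [set v : subvs_of (tangent p) |
           wedge (iota_form v (omega p)) (iota_form v (omega p)) = 0] = [set 0]
    & complex_type (omega p)].
Proof.
split; [by [] | exact: Delta_omega | split; last exact: Delta_omega].
  by rewrite dimvf /dim /= dim_tangent.
move=> v v0; have : Delta (omega p) v by rewrite /Delta /= v0 wedge0f.
by rewrite Delta_omega.
Qed.
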